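(* Let $\alpha$ be an infinite ordinal. For every finite $\beta\ge1$, the free algebra $\mathfrak{Fr}_\beta SA_\alpha$ of $SA_\alpha$ on $\beta$ free generators is infinite. Furthermore, if $\beta$ is infinite, then $\mathfrak{Fr}_\beta SA_\alpha$ is atomless. In particular, $SA_\alpha$ is not locally finite.
   Context: For distinct $i,j$, $[i,j]$ is the transposition swapping $i$ and $j$, and $[i|j]$ is the map sending $i$ to $j$ and fixing everything else. For finite $n\geq 2$, $\Sigma_n$ is the following finite set of equations in the type $\{\cdot,-,s^i_j,s_{ij}\}_{i\ne j\in n}$: (a) the Boolean algebra axioms; (b) each $s_{ij}$ and each $s^i_j$ is a Boolean endomorphism; (c) for a fixed finite presentation of the monoid ${}^nn$ (all maps $n\to n$ under composition, $n=\{0,\dots,n-1\}$) in the generators $[i,j],[i|j]$, all equations $s_{g_1}\cdots s_{g_m}x=s_{h_1}\cdots s_{h_k}x$ for the defining relations $g_1\circ\cdots\circ g_m=h_1\circ\cdots\circ h_k$, where $s_{[i,j]}=s_{ij}$, $s_{[i|j]}=s^i_j$. $\Sigma_\alpha$ is the set of all equations in the type $\{\cdot,-,s^i_j,s_{ij}\}_{i\neq j\in\alpha}$ obtained from equations in $\Sigma_n$, $2\le n<\omega$, by replacing the indices along an injection $\rho:n\to\alpha$. $SA_\alpha=\mathbf{Mod}(\Sigma_\alpha)$. An algebra is atomless if its Boolean reduct has no atoms; a variety is locally finite if all its finitely generated members are finite. *)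

(* Defs.v *)
From HB Require Import structures.
From mathcomp Require Import all_boot all_order perm.
From mathcomp Require Import boolp classical_sets functions cardinality.

Set Implicit Arguments.
Unset Strict Implicit.
Unset Printing Implicit Defensive.

Local Open Scope classical_set_scope.
Local Open Scope quotient_scope.

Definition offdiag (I : eqType) := {p : I * I | p.1 != p.2}.

(* [Swap (i, j)] names the transposition [i,j] and [Repl (i, j)] names the
   replacement [i|j].  Both are indexed by ordered pairs, so [i,j] and [j,i]
   are different symbols (hence so are s_ij and s_ji). *)
Inductive gen (I : eqType) : Type :=
| Swap of offdiag I
| Repl of offdiag I.

HB.instance Definition _ (I : eqType) := gen_eqMixin (gen I).

Record algebra (I : eqType) := Algebra {
  carrier :> Type;
  meet : carrier -> carrier -> carrier;
  compl : carrier -> carrier;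
  subst : gen I -> carrier -> carrier
}.

Inductive term (I : eqType) (X : Type) : Type :=
| Var of X
| Meet of term I X & term I X
| Compl of term I X
| Subst of gen I & term I X.

Arguments Var {I X}.

HB.instance Definition _ (I : eqType) (X : Type) := gen_eqMixin (term I X).
HB.instance Definition _ (I : eqType) (X : Type) := gen_choiceMixin (term I X).

Fixpoint eval (I : eqType) (X : Type) (A : algebra I) (v : X -> A)
    (t : term I X) : A :=
  match t with
  | Var x => v x
  | Meet t u => meet (eval v t) (eval v u)
  | Compl t => compl (eval v t)
  | Subst g t => subst g (eval v t)
  end.

Definition equation (I : eqType) := (term I nat * term I nat)%type.

Definition satisfies (I : eqType) (A : algebra I) (e : equation I) : Prop :=
  forall v : nat -> A, eval v e.1 = eval v e.2.

(* As the type has no constant symbol, the usual convention that algebras are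
   nonempty has to be imposed. *)
Definition Mod (I : eqType) (E : set (equation I)) (A : algebra I) : Prop :=
  [set: A] !=set0 /\ forall e, E e -> satisfies A e.

Definition word (n : nat) := seq (gen 'I_n).

Definition gen_map (n : nat) (g : gen 'I_n) : 'I_n -> 'I_n :=
  match g with
  | Swap p => tperm (val p).1 (val p).2
  | Repl p => fun k => if k == (val p).1 then (val p).2 else k
  end.

(* The word g_1 ... g_m denotes g_1 \o ... \o g_m. *)
Definition word_map (n : nat) (w : word n) : 'I_n -> 'I_n :=
  foldr (fun g f => gen_map g \o f) id w.

Inductive word_congr (n : nat) (R : seq (word n * word n)) :
    word n -> word n -> Prop :=
| wc_rel u v : (u, v) \in R -> word_congr R u v
| wc_refl u : word_congr R u u
| wc_sym u v : word_congr R u v -> word_congr R v u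
| wc_trans u v w : word_congr R u v -> word_congr R v w -> word_congr R u w
| wc_cat u u' v v' :
    word_congr R u u' -> word_congr R v v' -> word_congr R (u ++ v) (u' ++ v').

Definition presents (n : nat) (R : seq (word n * word n)) : Prop :=
  (forall f : 'I_n -> 'I_n, exists w, word_map w =1 f) /\
  (forall u v, word_congr R u v <-> word_map u =1 word_map v).

Section Equations.
Variable I : eqType.

Let x : term I nat := Var 0.
Let y : term I nat := Var 1.
Let z : term I nat := Var 2.
Let join (t u : term I nat) := Compl (Meet (Compl t) (Compl u)).

(* x . -x and x + -x are constant and serve as 0 and 1. *)
Definition BA_axioms : seq (equation I) := [::
  (Meet x y, Meet y x);
  (join x y, join y x);
  (Meet x (Meet y z), Meet (Meet x y) z);
  (join x (join y z), join (join x y) z);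
  (Meet x (join x y), x);
  (join x (Meet x y), x);
  (Meet x (join y z), join (Meet x y) (Meet x z));
  (join x (Meet y z), Meet (join x y) (join x z));
  (Meet x (Compl x), Meet y (Compl y));
  (join x (Compl x), join y (Compl y));
  (join x (Meet y (Compl y)), x);
  (Meet x (join y (Compl y)), x)].

Definition endo_meet (g : gen I) : equation I :=
  (Subst g (Meet x y), Meet (Subst g x) (Subst g y)).

Definition endo_compl (g : gen I) : equation I :=
  (Subst g (Compl x), Compl (Subst g x)).

Definition word_equation (r : seq (gen I) * seq (gen I)) : equation I :=
  (foldr (@Subst I nat) x r.1, foldr (@Subst I nat) x r.2).

End Equations.

Definition Sigma_fin (n : nat) (R : seq (word n * word n)) :
    set (equation 'I_n) :=
  [set e | [\/ e \in BA_axioms 'I_n,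
               exists g, e = endo_meet g \/ e = endo_compl g |
               exists2 r, r \in R & e = word_equation r]].

Section Reindex.
Variables (I J : eqType) (rho : I -> J) (rho_inj : injective rho).

Lemma reindex_subproof (p : offdiag I) :
  (rho (val p).1, rho (val p).2).1 != (rho (val p).1, rho (val p).2).2.
Proof. by rewrite /= (inj_eq rho_inj) (valP p). Qed.

Definition reindex_pair (p : offdiag I) : offdiag J :=
  Sub (rho (val p).1, rho (val p).2) (reindex_subproof p).

Definition reindex_gen (g : gen I) : gen J :=
  match g with
  | Swap p => Swap (reindex_pair p)
  | Repl p => Repl (reindex_pair p)
  end.

Fixpoint reindex (X : Type) (t : term I X) : term J X :=
  match t with
  | Var x => Var x
  | Meet t u => Meet (reindex t) (reindex u)
  | Compl t => Compl (reindex t)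
  | Subst g t => Subst (reindex_gen g) (reindex t)
  end.

Definition reindex_equation (e : equation I) : equation J :=
  (reindex e.1, reindex e.2).

End Reindex.

(* [R n] is the fixed finite presentation used in Sigma_n. *)
Definition Sigma (R : forall n, seq (word n * word n)) (I : eqType) :
    set (equation I) :=
  [set e | exists n (rho : 'I_n -> I) (rho_inj : injective rho) e0,
     [/\ (2 <= n)%N, Sigma_fin (R n) e0 & e = reindex_equation rho_inj e0]].

Arguments Sigma R I : clear implicits.

Definition SA (R : forall n, seq (word n * word n)) (I : eqType) :
    algebra I -> Prop := Mod (Sigma R I).

Arguments SA R I : clear implicits.

Section Free.
Variables (I : eqType) (K : algebra I -> Prop) (X : Type).

Definition free_rel (t u : term I X) : bool :=
  `[< forall A : algebra I, K A -> forall v : X -> A, eval v t = eval v u >].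

Lemma free_rel_equiv : equiv_class_of free_rel.
Proof.
split.
- by move=> t; apply/asboolP.
- by move=> t u; apply/asboolP/asboolP => E A KA v; rewrite E.
- move=> t u w /asboolP E1 /asboolP E2.
  by apply/asboolP => A KA v; rewrite E1 ?E2.
Qed.

Canonical free_equiv := EquivRelPack free_rel_equiv.

Definition free_carrier := {eq_quot free_equiv}.

Definition free_algebra : algebra I := {|
  carrier := free_carrier;
  meet := fun a b => \pi_free_carrier (Meet (repr a) (repr b));
  compl := fun a => \pi_free_carrier (Compl (repr a));
  subst := fun g a => \pi_free_carrier (Subst g (repr a))
|}.

Definition free_gen (x : X) : free_algebra := \pi_free_carrier (Var x).

End Free.

Definition hom (I : eqType) (A B : algebra I) (f : A -> B) : Prop :=
  [/\ forall a b, f (meet a b) = meet (f a) (f b),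
      forall a, f (compl a) = compl (f a) &
      forall g a, f (subst g a) = subst g (f a)].

Section FreeTheory.
Variables (I : eqType) (X : Type).

Lemma free_eqP (K : algebra I -> Prop) (t u : term I X) :
  \pi_(free_carrier K X) t = \pi_(free_carrier K X) u <->
  forall A : algebra I, K A -> forall v : X -> A, eval v t = eval v u.
Proof.
split=> [E|E]; last by apply/eqmodP/asboolP.
by apply/asboolP; move/eqmodP: E.
Qed.

Lemma free_repr (K : algebra I -> Prop) (t : term I X) (A : algebra I) (v : X -> A) :
  K A -> eval v (repr (\pi_(free_carrier K X) t)) = eval v t.
Proof. by move=> KA; apply: (free_eqP K _ _).1 KA v; rewrite reprK. Qed.

Lemma eval_hom (Y : Type) (A B : algebra I) (f : A -> B) (v : Y -> A)
  (t : term I Y) : hom f -> f (eval v t) = eval (f \o v) t.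
Proof.
case=> fM fC fS; elim: t => [y|t IHt u IHu|t IHt|g t IHt] //=.
- by rewrite fM IHt IHu.
- by rewrite fC IHt.
- by rewrite fS IHt.
Qed.

Lemma free_lift_hom (K : algebra I -> Prop) (A : algebra I) (v : X -> A) :
  K A -> hom (fun a : free_algebra K X => eval v (repr a)).
Proof. by move=> KA; split=> *; rewrite free_repr. Qed.

Lemma free_eval (K : algebra I -> Prop) (t : term I X) :
  eval (@free_gen I K X) t = \pi_(free_carrier K X) t.
Proof.
elim: t => [x|t IHt u IHu|t IHt|g t IHt] //=; rewrite ?IHt ?IHu;
  by apply/free_eqP => A KA v /=; rewrite !free_repr.
Qed.

(* [free_algebra K X] is free over K on [free_gen], and belongs to K when K is
   an equational class and X is nonempty. *)
Lemma free_universal (K : algebra I -> Prop) (A : algebra I) (v : X -> A) :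
  K A ->
  exists! f : free_algebra K X -> A, hom f /\ (forall x, f (free_gen K x) = v x).
Proof.
move=> KA; exists (fun a : free_algebra K X => eval v (repr a)); split.
  by split=> [|x]; [exact: free_lift_hom | rewrite free_repr].
move=> f [fh fv]; apply/funext => a; rewrite -[in RHS](reprK a).
by rewrite -free_eval (eval_hom _ _ fh); congr eval; apply/funext => x; rewrite /= fv.
Qed.

Lemma free_mem (E : set (equation I)) :
  [set: X] !=set0 -> Mod E (free_algebra (Mod E) X).
Proof.
case=> x0 _; split; first by exists (free_gen _ x0).
move=> e Ee v; rewrite -[LHS]reprK -[RHS]reprK; apply/free_eqP => A KA w.
have fh := free_lift_hom w KA.
by rewrite (eval_hom v e.1 fh) (eval_hom v e.2 fh); apply: KA.2.
Qed.

End FreeTheory.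

Section Notions.
Variable I : eqType.

Definition zero_elt (A : algebra I) (a : A) : Prop := a = meet a (compl a).

Definition le_elt (A : algebra I) (a b : A) : Prop := meet a b = a.

Definition atom (A : algebra I) (a : A) : Prop :=
  ~ zero_elt a /\ forall b : A, le_elt b a -> zero_elt b \/ b = a.

Definition atomless (A : algebra I) : Prop := ~ exists a : A, atom a.

Definition subuniverse (A : algebra I) (S : set A) : Prop :=
  [/\ forall a b, S a -> S b -> S (meet a b),
      forall a, S a -> S (compl a) &
      forall g a, S a -> S (subst g a)].

Definition finitely_generated (A : algebra I) : Prop :=
  exists2 G : set A, finite_set G &
    forall S : set A, subuniverse S -> G `<=` S -> S = [set: A].

Definition locally_finite (K : algebra I -> Prop) : Prop :=
  forall A : algebra I, K A -> finitely_generated A -> finite_set [set: A].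

End Notions.

(* Main.v *)
(* Full set algebras of sets of sequences, on which a map tau acts by
   X |-> {q | q o tau \in X}, lie in SA_alpha.  In them the images of the set
   {q | q i0} under the transpositions [i0, i] are the pairwise distinct sets
   {q | q i}, so one free generator already has infinitely many distinct
   translates.  With infinitely many generators, every nonzero element a,
   being given by a term in finitely many of them, is split by any generator x
   that does not occur in that term: a . x is neither 0 nor a, as one sees by
   sending x to 1 and to 0. *)

Require Import Defs.
From mathcomp Require Import all_boot all_order perm.
From mathcomp Require Import boolp classical_sets functions cardinality.

Set Implicit Arguments.
Unset Strict Implicit.
Unset Printing Implicit Defensive.

Local Open Scope classical_set_scope.

Section SetAlgebra.
Variables (I : eqType) (U : Type).

(** The transposition is spelled out by cases because [tperm] requires a finite type, while [I] may
    be infinite. *)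
Definition gen_fun (g : gen I) : I -> I :=
  match g with
  | Swap p => fun k => if k == (val p).1 then (val p).2
                       else if k == (val p).2 then (val p).1 else k
  | Repl p => fun k => if k == (val p).1 then (val p).2 else k
  end.

Definition set_algebra : algebra I := {|
  carrier := (I -> U) -> bool;
  meet := fun a b q => a q && b q;
  compl := fun a q => ~~ a q;
  subst := fun g a q => a (q \o gen_fun g)
|}.

End SetAlgebra.

Section Reindexing.
Variables (n : nat) (I : eqType) (rho : 'I_n -> I) (rho_inj : injective rho).

Lemma gen_fun_reindex (g : gen 'I_n) (k : 'I_n) :
  gen_fun (reindex_gen rho_inj g) (rho k) = rho (gen_map g k).
Proof.
case: g => p /=; last by rewrite (inj_eq rho_inj); case: eqP.
rewrite !(inj_eq rho_inj).
by case: tpermP => [->|->|/eqP/negPf-> /eqP/negPf->] //; rewrite eqxx //; case: eqP => // ->.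
Qed.

Lemma gen_fun_reindex_out (g : gen 'I_n) (i : I) :
  (forall k, i != rho k) -> gen_fun (reindex_gen rho_inj g) i = i.
Proof. by move=> out; case: g => p /=; rewrite !(negPf (out _)). Qed.

(** The map [f] extends [word_map w] along [rho] by the identity. Precomposition on sequences
    reverses order twice, so nested substitutions compose in the order of the word. *)
Lemma reindex_word_fun (w : word n) :
  exists f : I -> I,
    [/\ forall k, f (rho k) = rho (word_map w k),
        forall i, (forall k, i != rho k) -> f i = i &
        forall (U : Type) (v : nat -> set_algebra I U) (q : I -> U),
          eval v (Defs.reindex rho_inj (foldr (@Subst _ nat) (Var 0) w)) q =
          v 0 (q \o f)].
Proof.
elim: w => [|g w [f [f_in f_out f_eval]]]; first by exists id.
exists (gen_fun (reindex_gen rho_inj g) \o f); split.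
- by move=> k; rewrite /= f_in gen_fun_reindex.
- by move=> i out; rewrite /= f_out // gen_fun_reindex_out.
- by move=> U v q; rewrite /= f_eval.
Qed.

End Reindexing.

Lemma set_algebra_SA (R : forall n, seq (word n * word n)) (I : eqType)
    (U : Type) :
  (forall n, (2 <= n)%N -> presents (R n)) -> SA R I (set_algebra I U).
Proof.
move=> R_pres; split; first by exists (fun=> true).
move=> _ [n [rho [rho_inj [e [n_ge2 Se ->]]]]] v.
apply/funext => q; case: Se => [|[g [->|->]]|[[u w] Ruw ->]] //=.
- rewrite /BA_axioms !in_cons in_nil orbF.
  repeat (case/orP; last first);
    by move=> /eqP-> /=; case: (v 0 q); case: (v 1 q); case: (v 2 q).
- have [f [f_in f_out f_eval]] := reindex_word_fun rho_inj u.
  have [h [h_in h_out h_eval]] := reindex_word_fun rho_inj w.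
  rewrite f_eval h_eval; congr (v 0 (q \o _)); apply/funext => i.
  (* On the range of [rho] both maps agree since [R n] presents the monoid; off it both are the
     identity. *)
  have [[k ->]|out] := pselect (exists k, i = rho k).
    by rewrite f_in h_in ((R_pres n n_ge2).2 u w).1 //; exact: wc_rel.
  have {}out k : i != rho k by apply/eqP => ik; apply: out; exists k.
  by rewrite f_out // h_out.
Qed.

Section InfiniteFree.
Variables (R : forall n, seq (word n * word n)) (I : eqType) (X : Type).
Hypothesis R_pres : forall n, (2 <= n)%N -> presents (R n).
Hypothesis I_inf : infinite_set [set: I].

Lemma infinite_free (x : X) : infinite_set [set: free_algebra (SA R I) X].
Proof.
have [i0 _] : [set: I] !=set0.
  by apply/set0P/eqP => I0; apply: I_inf; rewrite I0; exact: finite_set0.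
(* There is no transposition symbol for the pair [(i0, i0)]; the variable itself serves for
   [i = i0]. *)
pose t i : term I X :=
  if insub (i0, i) is Some p then Subst (Swap p) (Var x) else Var x.
pose f i : free_algebra (SA R I) X := (\pi_(free_carrier (SA R I) X) (t i))%qT.
have t_eval i q :
    eval (fun=> (fun q => q i0) : set_algebra I bool) (t i) q = q i.
  rewrite /t; case: insubP => [p _ pE|] /=; first by rewrite pE eqxx.
  by rewrite /= negbK => /eqP <-.
have f_inj : injective f.
  move=> i j /free_eqP/(_ _ (set_algebra_SA I bool R_pres)) E.
  (* At the indicator function of [i], the two sides become [true] and [j == i]. *)
  have := congr1 (@^~ (eq_op^~ i)) (E (fun=> fun q => q i0)).
  by rewrite !t_eval /= eqxx => /esym/eqP.
move=> fin; apply: I_inf; rewrite -(preimage_setT f).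
by apply: finite_preimage fin => i j _ _; exact: f_inj.
Qed.

End InfiniteFree.

Lemma free_finitely_generated (I : eqType) (K : algebra I -> Prop) (X : Type) :
  finite_set [set: X] -> finitely_generated (free_algebra K X).
Proof.
move=> X_fin; exists (range (@free_gen I K X)); first exact: finite_image.
move=> S [SM SC SS] SX; apply/seteqP; split=> // a _.
rewrite -[a]reprK -free_eval; elim: (repr a) => /= [y|u Su w Sw|u Su|g u Su].
- by apply: SX; exists y.
- exact: SM.
- exact: SC.
- exact: SS.
Qed.

Fixpoint vars (I : eqType) (X : Type) (t : term I X) : set X :=
  match t with
  | Var x => [set x]
  | Meet t u => vars t `|` vars u
  | Compl t => vars t
  | Subst _ t => vars t
  end.

Lemma finite_vars (I : eqType) (X : Type) (t : term I X) : finite_set (vars t).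
Proof.
by elim: t => //= t IHt u IHu; rewrite finite_setU.
Qed.

Lemma eq_eval_vars (I : eqType) (X : Type) (A : algebra I) (v w : X -> A)
    (t : term I X) :
  (forall x, vars t x -> v x = w x) -> eval v t = eval w t.
Proof.
elim: t => [x|t IHt u IHu|t IHt|g t IHt] /= vw.
- exact: vw.
- by rewrite IHt ?IHu // => x tx; apply: vw; [right|left].
- by rewrite IHt.
- by rewrite IHt.
Qed.

Section Atomless.
Variables (R : forall n, seq (word n * word n)) (I : eqType).
Hypothesis I_inf : infinite_set [set: I].

(** Boolean axioms enter [Sigma] only through an injection of some ['I_n] with [n] at least 2. *)
Lemma injection_I2 : exists rho : 'I_2 -> I, injective rho.
Proof.
have [i _] := infinite_setN0 I_inf.
have [j [_ ji]] : ([set: I] `\` [set i]) !=set0.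
  by apply/infinite_setN0/infinite_setD => //; exact: finite_set1.
exists (fun k => if k == ord0 then i else j) => k l /=.
have [->|k0] := eqVneq k ord0; have [->|l0] := eqVneq l ord0 => //.
  by move=> ij; case: ji.
move=> _; apply: val_inj; move: k0 l0.
by case: k l => [[|[|//]] ?] [[|[|//]] ?].
Qed.

Section BooleanReduct.
Variable A : algebra I.
Hypothesis SA_A : SA R I A.

(** As the default of [nth], [c] is the value of every variable from index 2 on. *)
Let vals (a b c : A) (n : nat) : A := nth c [:: a; b] n.

Lemma SA_BA_axiom (k : nat) : k < 12 ->
  exists2 rho : 'I_2 -> I, injective rho &
  forall (rho_inj : injective rho) (v : nat -> A),
    let e := nth (Var 0, Var 0) (BA_axioms 'I_2) k in
    eval v (Defs.reindex rho_inj e.1) = eval v (Defs.reindex rho_inj e.2).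
Proof.
move=> k_lt; have [rho rho_inj] := injection_I2.
exists rho => // rho_inj' v; apply: (SA_A.2 (reindex_equation rho_inj' _)).
exists 2, rho, rho_inj', (nth (Var 0, Var 0) (BA_axioms 'I_2) k); split=> //.
by constructor; exact: mem_nth.
Qed.

Lemma meetC (a b : A) : meet a b = meet b a.
Proof.
by have [rho inj /(_ inj (vals a b b))] := SA_BA_axiom (isT : 0 < 12).
Qed.

Lemma meetA (a b c : A) : meet a (meet b c) = meet (meet a b) c.
Proof.
by have [rho inj /(_ inj (vals a b c))] := SA_BA_axiom (isT : 2 < 12).
Qed.

Lemma meetxx (a : A) : meet a a = a.
Proof.
(* Idempotence follows from the two absorption laws: [a + a.a = a], hence
   [a = a.(a + a.a) = a.a]. *)
have [rho inj /(_ inj (vals a a a)) /= joinKI] := SA_BA_axiom (isT : 5 < 12).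
have [rho' inj' /(_ inj' (vals a (meet a a) a)) /=] :=
  SA_BA_axiom (isT : 4 < 12).
by rewrite joinKI.
Qed.

Lemma meet_complE (a b : A) : meet a (compl a) = meet b (compl b).
Proof.
by have [rho inj /(_ inj (vals a b b))] := SA_BA_axiom (isT : 8 < 12).
Qed.

Lemma meet_zero (a b : A) : meet a (meet b (compl b)) = meet a (compl a).
Proof. by rewrite (meet_complE b a) meetA meetxx. Qed.

Lemma meet_one (a b : A) :
  meet a (compl (meet (compl b) (compl (compl b)))) = a.
Proof.
by have [rho inj /(_ inj (vals a b b))] := SA_BA_axiom (isT : 11 < 12).
Qed.

End BooleanReduct.

Lemma atomless_free (X : Type) :
  infinite_set [set: X] -> atomless (free_algebra (SA R I) X).
Proof.
move=> X_inf [a [a_nz a_min]]; set t := repr a.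
have aE : a = (\pi_(free_carrier (SA R I) X) t)%qT by rewrite reprK.
have [x [_ tx]] : ([set: X] `\` vars t) !=set0.
  by apply/infinite_setN0/infinite_setD => //; exact: finite_vars.
(* If [t] vanished under all valuations in members of SA, the class [a] would be zero. *)
have [A [SA_A [v v_nz]]] : exists A, SA R I A /\
    exists v : X -> A, eval v t <> meet (eval v t) (compl (eval v t)).
  apply: contra_notP a_nz => zero; rewrite /zero_elt {1}aE.
  apply/free_eqP => A SA_A v /=; rewrite !free_repr //=.
  by apply: contra_notP zero => nz; exists A; split=> //; exists v.
(* Resetting [x] to any [c] leaves the value of [t] unchanged, as [x] does not occur in [t]. *)
pose upd c y := if pselect (y = x) then c else v y.
have updx c : upd c x = c by rewrite /upd; case: pselect.
have updt c : eval (upd c) t = eval v t.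
  apply: eq_eval_vars => y ty; rewrite /upd; case: pselect => // yx.
  by case: tx; rewrite -yx.
pose b : free_algebra (SA R I) X := meet a (free_gen (SA R I) x).
pose h c (u : free_algebra (SA R I) X) := eval (upd c) (repr u).
have h_hom c : hom (h c) := free_lift_hom (upd c) SA_A.
have h_b c : h c b = meet (eval v t) c.
  by have [-> _ _] := h_hom c; rewrite /h updt free_repr //= updx.
have free_SA : SA R I (free_algebra (SA R I) X) by apply: free_mem; exists x.
have [|b_zero|ba] := a_min b.
- by rewrite /le_elt meetC // meetA // meetxx.
(* This [c] is 1, written as [v x + -(v x)]; it sends [b] to the value of [t], which would then be
   zero. *)
- apply: v_nz; pose c := compl (meet (compl (v x)) (compl (compl (v x)))).
  have [hM hC _] := h_hom c.
  by have := congr1 (h c) b_zero; rewrite hM hC h_b meet_one.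
(* Sending [x] to 0 kills [b] but not [a]. *)
- apply: v_nz; have := congr1 (h (meet (v x) (compl (v x)))) ba.
  by rewrite h_b meet_zero // /h updt.
Qed.

End Atomless.

Theorem theorem3p43 (d : Order.disp_t) (alpha : orderType d)
    (alpha_wf : well_founded (fun i j : alpha => (i < j)%O))
    (alpha_inf : infinite_set [set: alpha])
    (R : forall n : nat, seq (word n * word n))
    (R_pres : forall n : nat, (2 <= n)%N -> presents (R n)) :
  (forall beta : nat, (1 <= beta)%N ->
     infinite_set [set: free_algebra (SA R alpha) 'I_beta]) /\
  (forall beta : Type, infinite_set [set: beta] ->
     atomless (free_algebra (SA R alpha) beta)) /\
  ~ locally_finite (SA R alpha).
Proof.
have free_inf (X : Type) := infinite_free (X := X) R_pres alpha_inf.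
split; last split.
- by case=> // beta _; apply: free_inf; exact: ord0.
- by move=> beta; exact: atomless_free.
(* The free algebra on one generator refutes local finiteness. *)
- move=> lf; apply: (free_inf 'I_1 ord0); apply: lf.
    by apply: free_mem; exists ord0.
  by apply: free_finitely_generated; exact: finite_finset.
Qed.
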